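(* Let $C$ be a real constant such that for every integer $N \geq 2$, all distinct real numbers $\lambda_1,\dots,\lambda_N$, and all complex numbers $w_1,\dots,w_N$, one has $$\Big| \sum_{\substack{1 \leq m,n \leq N \\ m \neq n}} \frac{w_m \overline{w_n}}{\lambda_m - \lambda_n} \Big| \leq C \sum_{1\leq m \leq N} \frac{|w_m|^2}{\delta_m},$$ where $\delta_m = \min_{1 \le k \le N,\; k\neq m}|\lambda_k-\lambda_m|$ for each $1 \le m \le N$. Then $C > \pi$.
   Context: The constant $C$ is absolute: it does not depend on $N$, the $\lambda_m$, or the $w_m$. The quantity $\delta_m$ is the distance from $\lambda_m$ to the nearest other point of the configuration $\lambda_1,\dots,\lambda_N$. *)

(* Defs.v *)
From mathcomp Require Import all_boot all_order all_algebra.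
From mathcomp Require Import complex.
From mathcomp Require Import all_classical all_reals all_analysis.

Set Implicit Arguments.
Unset Strict Implicit.
Unset Printing Implicit Defensive.

Import Order.TTheory GRing.Theory Num.Theory.

Local Open Scope ring_scope.

(* The minimum is taken in \bar R, with +oo as the value of the empty minimum;
   [min_gapP] shows that for N >= 2 the result is the real minimum. *)
Definition min_gap (R : realType) (N : nat) (lambda : 'I_N -> R) (m : 'I_N) : R :=
  fine (\big[Order.min/+oo%E]_(k < N | k != m) (`|lambda k - lambda m|)%:E).

Lemma min_gapP (R : realType) (N : nat) (lambda : 'I_N -> R) (m : 'I_N) :
  (2 <= N)%N ->
  (exists2 k, k != m & min_gap lambda m = `|lambda k - lambda m|) /\
  (forall k, k != m -> min_gap lambda m <= `|lambda k - lambda m|).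
Proof.
move=> N2.
have [j jm] : exists j : 'I_N, j != m.
  have /card_gt0P[j jm] : (0 < #|predC1 m|)%N.
    by rewrite cardC1 card_ord -subn1 subn_gt0.
  by exists j.
rewrite /min_gap (bigmin_eq_arg _ j) //; last by move=> i _; exact: leey.
case: arg_minP => //= i im imin; split; first by exists i.
by move=> k km; have := imin k km; rewrite lee_fin.
Qed.

(* Main.v *)
(** Suppose that the inequality holds with C = pi.  Apply it to the points
    x_j = 1/(n+j), 0 <= j <= M, together with the isolated point 0, with the
    weights x_j p_j e^(i(2j-M)w) for real p_j.  Since x_j x_k/(x_j - x_k) =
    1/(k-j), the x_j contribute a Hilbert form with kernel 1/(k-j), and they
    interact with 0 through P(w) = sum_j p_j e^(i(2j-M)w) alone.  Optimizing over
    the weight at 0 gives a pointwise bound |P|^2 <= pi(n+M) X, where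
    X(w) = pi(1+1/n)|p|^2 - sum_(j<>k) p_j p_k sin(2(j-k)w)/(j-k)
    has derivative 2|p|^2 - 2|P|^2.  By Gronwall, X decays at most like
    e^(-2pi(n+M)w).  Up to an error O(w + 1/n)|p|^2, X(w) is twice the integral of
    |P|^2 over [w, pi/2], so this fails as soon as |P|^2 drops much faster.  That
    happens for P(w) = U_M(cos w/cos x) with U_M the Chebyshev polynomial of the
    second kind, n = M and x = r/M: when w goes from x - 2/M to x + 1/M, the
    integral falls by a factor of order r^2, while the Gronwall factor is
    e^(12 pi).  Take r large, and then M large to absorb the error. *)

Require Import Defs.
From mathcomp Require Import all_boot all_order all_algebra.
From mathcomp Require Import complex.
From mathcomp Require Import all_classical all_reals all_analysis.
From mathcomp Require Import ring lra.

Set Implicit Arguments.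
Unset Strict Implicit.
Unset Printing Implicit Defensive.

Import Order.TTheory GRing.Theory Num.Theory.
Import numFieldNormedType.Exports.

Local Open Scope ring_scope.

(** * Chebyshev polynomials of the second kind *)

Section Chebyshev.
Variable R : realType.
Implicit Types (b v s q e w : R) (f : nat -> R).

Fixpoint chebU (k : nat) (v : R) : R :=
  if k is k1.+1 then
    if k1 is k2.+1 then 2 * v * chebU k1 v - chebU k2 v else 2 * v
  else 1.

Lemma chebUSS k v : chebU k.+2 v = 2 * v * chebU k.+1 v - chebU k v.
Proof. by []. Qed.

(** The step [(x, y) -> (y, 2 v y - x)] of the recursion preserves the quadratic form
    [x^2 - 2 v x y + y^2]. *)
Lemma chebU_invariant k v :
  chebU k.+1 v ^+ 2 - 2 * v * chebU k v * chebU k.+1 v + chebU k v ^+ 2 = 1.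
Proof.
elim: k => [|k IH]; first by rewrite /=; ring.
by rewrite -[RHS]IH chebUSS; ring.
Qed.

(** Completing the square in the invariant gives [(U_{k+1} - v U_k)^2 + (1 - v^2) U_k^2 = 1]. *)
Lemma chebU_sqr_le k v : (1 - v ^+ 2) * chebU k v ^+ 2 <= 1.
Proof.
have := chebU_invariant k v; have := sqr_ge0 (chebU k.+1 v - v * chebU k v).
by move: (chebU k v) (chebU k.+1 v) => x y; nra.
Qed.

(** Each step raises the increment by exactly [2 e U_{k+1}], and [U_{k+1} >= k + 2] makes this at
    least [e (k + 2) ((k + 3) - (k + 1))]. The two bounds feed each other, hence the joint
    induction. *)
Lemma chebU_ge_lin e k : 0 <= e ->
  k%:R + 1 <= chebU k (1 + e) /\
  1 + e * (k%:R + 1) * (k%:R + 2) <= chebU k.+1 (1 + e) - chebU k (1 + e).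
Proof.
move=> e0; elim: k => [|k [IH1 IH2]]; first by rewrite /=; split; lra.
have k0 : (0 : R) <= k%:R by rewrite ler0n.
rewrite chebUSS -[k.+1]addn1 natrD addn1.
have IH3 : k%:R + 1 + 1 <= chebU k.+1 (1 + e).
  have : 0 <= e * (k%:R + 1) * (k%:R + 2) by rewrite !mulr_ge0 ?addr_ge0.
  lra.
split=> //.
have : e * (k%:R + 2) <= e * chebU k.+1 (1 + e) by rewrite ler_wpM2l //; lra.
move: IH2; move: (chebU k _) (chebU k.+1 _) => x y.
lra.
Qed.

Lemma chebU_ge_cube e k : 0 <= e -> e * k%:R ^+ 3 / 3 <= chebU k (1 + e).
Proof.
move=> e0; elim: k => [|k IH]; first by rewrite /=; lra.
have k0 : (0 : R) <= k%:R by rewrite ler0n.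
have [_] := chebU_ge_lin k e0.
rewrite -[k.+1]addn1 natrD addn1.
move: (chebU k _) (chebU k.+1 _) IH => x y IH.
have : 0 <= e * k%:R by rewrite mulr_ge0.
have : 0 <= e * k%:R ^+ 2 by rewrite mulr_ge0 ?sqr_ge0.
rewrite !(exprS, expr0, mulr1); nra.
Qed.

(** By the invariant, [(U_{k+1} - v U_k)^2 = 1 + (v^2 - 1) U_k^2 <= (1 + s |U_k|)^2], whence
    [|U_{k+1}| <= q |U_k| + 1]. *)
Lemma chebU_le_pow v s q k : 0 <= v -> 0 <= s -> v ^+ 2 - 1 <= s ^+ 2 ->
  v + s <= q -> 1 <= q -> `|chebU k v| <= (k%:R + 1) * q ^+ k.
Proof.
move=> v0 s0 vs vsq q1; elim: k => [|k IH]; first by rewrite /= normr1; lra.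
have q0 : 0 <= q by lra.
have step : `|chebU k.+1 v| <= q * `|chebU k v| + 1.
  have a0 := normr_ge0 (chebU k v).
  have : `|chebU k.+1 v - v * chebU k v| <= s * `|chebU k v| + 1.
    rewrite -(@ler_pXn2r _ 2) ?nnegrE ?addr_ge0 ?mulr_ge0 //.
    rewrite -normrX ger0_norm ?sqr_ge0 //.
    have E := chebU_invariant k v; have aE : `|chebU k v| ^+ 2 = chebU k v ^+ 2.
      by rewrite -normrX ger0_norm // sqr_ge0.
    have := sqr_ge0 (chebU k v); have : 0 <= s * `|chebU k v| by rewrite mulr_ge0.
    move: aE a0 E; move: (chebU k v) `|chebU k v| (chebU k.+1 v) => x a y aE a0 E sa x0.
    have : (v ^+ 2 - 1) * a ^+ 2 <= s ^+ 2 * a ^+ 2 by rewrite ler_wpM2r ?sqr_ge0.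
    rewrite aE => H.
    have -> : (s * a + 1) ^+ 2 = s ^+ 2 * x ^+ 2 + 2 * (s * a) + 1 by rewrite -aE; ring.
    have -> : (y - v * x) ^+ 2 = 1 + (v ^+ 2 - 1) * x ^+ 2 by lra.
    lra.
  have : `|chebU k.+1 v| <= `|chebU k.+1 v - v * chebU k v| + `|v * chebU k v|.
    by rewrite -[X in `|X| <= _](subrK (v * chebU k v)) ler_normD.
  rewrite normrM (ger0_norm v0).
  have : (v + s) * `|chebU k v| <= q * `|chebU k v| by rewrite ler_wpM2r.
  lra.
apply: (le_trans step).
have : q * `|chebU k v| <= q * ((k%:R + 1) * q ^+ k) by rewrite ler_wpM2l.
have : 1 <= q ^+ k.+1 by rewrite exprn_ege1.
rewrite -natr1 exprS; lra.
Qed.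

Definition shift f (j : nat) : R := if j is j1.+1 then f j1 else 0.

(* [chebc b k] lists the coefficients of [chebU k (b * cos w)] on the exponentials
   [e^(i (2 j - k) w)]; the recursion is that of [chebU], since
   [2 b cos w = b (e^(i w) + e^(- i w))]. *)
Fixpoint chebc b (k : nat) : nat -> R :=
  if k is k1.+1 then
    if k1 is k2.+1 then
      fun j => b * (chebc b k1 j + shift (chebc b k1) j) - shift (chebc b k2) j
    else fun j => b * (chebc b k1 j + shift (chebc b k1) j)
  else fun j => (j == 0)%:R.

Lemma chebc_eq0 b k j : (k < j)%N -> chebc b k j = 0.
Proof.
suff H : forall j, ((k < j)%N -> chebc b k j = 0) /\ ((k.+1 < j)%N -> chebc b k.+1 j = 0).
  by have [] := H j.
elim: k => {j} [|k IH] j.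
  split; case: j => // -[|j] //= _; rewrite ?addr0 ?mulr0 //.
have [H1 H2] := IH j; split=> // kj.
have -> : chebc b k.+2 j =
    b * (chebc b k.+1 j + shift (chebc b k.+1) j) - shift (chebc b k) j by [].
case: j kj {IH H1 H2} (IH j) (IH j.-1) => // j kj [_ H2] [H3 H4] /=.
rewrite -/(chebc b k.+1) H2 ?H4 ?H3; first by rewrite addr0 mulr0 subr0.
- by apply: ltnW.
- by [].
- by apply: ltnW.
Qed.

Lemma sum_shift f (g : nat -> R) n :
  \sum_(j < n.+1) shift f j * g j = \sum_(j < n) f j * g j.+1.
Proof. by rewrite big_ord_recl /= mul0r add0r; apply: eq_bigr => i _. Qed.

(** The test function [g] is arbitrary, so that the cosine and sine sums of [chebc_trig] both follow
    from one recursion. *)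
Lemma sum_chebcSS b k (g : nat -> R) :
  \sum_(j < k.+3) chebc b k.+2 j * g j =
  b * \sum_(j < k.+2) chebc b k.+1 j * (g j + g j.+1)
  - \sum_(j < k.+1) chebc b k j * g j.+1.
Proof.
transitivity (b * (\sum_(j < k.+3) chebc b k.+1 j * g j
    + \sum_(j < k.+3) shift (chebc b k.+1) j * g j)
    - \sum_(j < k.+3) shift (chebc b k) j * g j).
  rewrite -big_split mulr_sumr -sumrB; apply: eq_bigr => j _ /=.
  by rewrite -/(chebc b k.+1); ring.
rewrite !sum_shift big_ord_recr /= -/(chebc b k.+1) (@chebc_eq0 b k.+1 k.+2) // mul0r addr0.
rewrite [X in _ - X]big_ord_recr /= (@chebc_eq0 b k k.+1) // mul0r addr0.
congr (_ * _ - _); rewrite -big_split; apply: eq_bigr => j _.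
by rewrite mulrDr.
Qed.

Lemma chebc_trig b k w :
  \sum_(j < k.+1) chebc b k j * cos ((2 * j%:R - k%:R) * w) = chebU k (b * cos w) /\
  \sum_(j < k.+1) chebc b k j * sin ((2 * j%:R - k%:R) * w) = 0.
Proof.
(* The recursion reaches back two degrees, so the induction carries two consecutive ones. *)
suff [] : (\sum_(j < k.+1) chebc b k j * cos ((2 * j%:R - k%:R) * w) = chebU k (b * cos w) /\
  \sum_(j < k.+1) chebc b k j * sin ((2 * j%:R - k%:R) * w) = 0) /\
  (\sum_(j < k.+2) chebc b k.+1 j * cos ((2 * j%:R - k.+1%:R) * w) = chebU k.+1 (b * cos w) /\
  \sum_(j < k.+2) chebc b k.+1 j * sin ((2 * j%:R - k.+1%:R) * w) = 0) by [].
elim: k => [|k [[C0 S0] [C1 S1]]].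
  rewrite !big_ord_recr !big_ord0 /=.
  have -> : (2 * 0%:R - 0%:R) * w = 0 by ring.
  have -> : (2 * 0%:R - 1) * w = - w by ring.
  have -> : (2 * 1 - 1) * w = w by ring.
  rewrite cosN sinN cos0 sin0; do ?split; ring.
split=> //.
have E1 (j : nat) : (2 * j%:R - k.+2%:R) * w = (2 * j%:R - k.+1%:R) * w - w.
  by rewrite -[k.+2]addn1 natrD; ring.
have E2 (j : nat) : (2 * j.+1%:R - k.+2%:R) * w = (2 * j%:R - k.+1%:R) * w + w.
  by rewrite -[k.+2]addn1 -[j.+1]addn1 !natrD; ring.
have E3 (j : nat) : (2 * j.+1%:R - k.+2%:R) * w = (2 * j%:R - k%:R) * w.
  by rewrite -[k.+2]addn2 -[j.+1]addn1 !natrD; ring.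
split.
  rewrite (@sum_chebcSS b k (fun j => cos ((2 * j%:R - k.+2%:R) * w))) chebUSS -C0 -C1.
  congr (_ - _); last by apply: eq_bigr => j _; rewrite E3.
  rewrite !mulr_sumr; apply: eq_bigr => j _.
  by rewrite E1 E2 !cosD cosN sinN; ring.
rewrite (@sum_chebcSS b k (fun j => sin ((2 * j%:R - k.+2%:R) * w))).
have -> : \sum_(j < k.+1) chebc b k j * sin ((2 * j.+1%:R - k.+2%:R) * w) = 0.
  by rewrite -[RHS]S0; apply: eq_bigr => j _; rewrite E3.
rewrite subr0 -[RHS](mulr0 (2 * (b * cos w))) -[in RHS]S1 !mulr_sumr.
by apply: eq_bigr => j _; rewrite E1 E2 !sinD cosN sinN; ring.
Qed.

End Chebyshev.

(** * The Hilbert form of a trigonometric polynomial *)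

Section Calculus.
Variable R : realType.
Implicit Types (f g : R -> R) (a b x w : R).

(** This stands in for integration: each integral estimate below is the monotonicity of a difference
    between [prim] and an explicit comparison primitive. *)
Lemma is_derive_homo f g a b : a <= b ->
  (forall x, a <= x <= b -> is_derive x 1 f (g x)) ->
  (forall x, a <= x <= b -> 0 <= g x) -> f a <= f b.
Proof.
move=> ab fg g0.
apply: (@ger0_derive1_le_cc R f a b) => //; rewrite ?in_itv /= ?lexx ?ab //.
- by move=> x /andP[ax xb]; have [] := fg x; rewrite ?(ltW ax) ?(ltW xb).
- move=> x /andP[ax xb]; have D : is_derive x 1 f (g x) by apply: fg; rewrite !ltW.
  by rewrite derive1E (@derive_val _ _ _ _ _ _ _ D) g0 // !ltW.
- apply: derivable_within_continuous => x; rewrite in_itv /= => xab.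
  by have [] := fg x xab.
Qed.

Lemma sin_le_id x : 0 <= x -> sin x <= x.
Proof.
move=> x0; rewrite -subr_ge0 -[X in X <= _](_ : 0 - sin 0 = 0); last by rewrite sin0 subr0.
by apply: (@is_derive_homo (fun t => t - sin t) (fun t => 1 - cos t)) => // t _;
  rewrite subr_ge0 cos_le1.
Qed.

Lemma cos_ge_sqr x : 0 <= x -> 1 - x ^+ 2 / 2 <= cos x.
Proof.
move=> x0; rewrite -subr_ge0 -[X in X <= _](_ : cos 0 - (1 - 0 ^+ 2 / 2) = 0); last first.
  by rewrite cos0; lra.
apply: (@is_derive_homo (fun t => cos t - (1 - t ^+ 2 / 2)) (fun t => t - sin t)) => // t t0.
  apply: is_derive_eq; rewrite ?scaler0 /GRing.scale /=; lra.
by rewrite subr_ge0 sin_le_id //; case/andP: t0.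
Qed.

Lemma sin_ge_half x : 0 <= x <= 1 -> x / 2 <= sin x.
Proof.
case/andP=> x0 x1; rewrite -subr_ge0 -[X in X <= _](_ : sin 0 - 0 / 2 = 0); last first.
  by rewrite sin0; lra.
apply: (@is_derive_homo (fun t => sin t - t / 2) (fun t => cos t - 1 / 2)) => // t /andP[t0 tx].
  apply: is_derive_eq; rewrite ?scaler0 /GRing.scale /=; lra.
by have := cos_ge_sqr t0; nra.
Qed.

End Calculus.

Section HilbertForm.
Variables (R : realType) (p : nat -> R) (M : nat).
Implicit Types (w t d : R).

Definition mass : R := \sum_(j < M.+1) p j ^+ 2.

(* The diagonal terms vanish because 0^-1 = 0. *)
Definition hilb w : R :=
  \sum_(j < M.+1) \sum_(k < M.+1)
    p j * p k * (sin (2 * (j%:R - k%:R) * w) / (j%:R - k%:R)).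

Definition cosum w : R := \sum_(j < M.+1) p j * cos ((2 * j%:R - M%:R) * w).

Definition sinum w : R := \sum_(j < M.+1) p j * sin ((2 * j%:R - M%:R) * w).

Lemma mass_ge0 : 0 <= mass.
Proof. by apply: sumr_ge0 => j _; exact: sqr_ge0. Qed.

(** For [d = 0] the function is 0 by the convention [0^-1 = 0]; the indicator then cancels
    [cos 0 = 1], so one formula covers diagonal and off-diagonal terms. *)
Lemma is_derive_sinc (a d w : R) :
  is_derive w 1 (fun t => a * (sin (2 * d * t) / d)) (a * (2 * (cos (2 * d * w) - (d == 0)%:R))).
Proof.
have [->|d0] := eqVneq d 0.
  rewrite (_ : (fun t => _) = cst 0); last first.
    by apply/funext => t; rewrite invr0 !mulr0.
  by rewrite mulr0 mul0r cos0 subrr !mulr0; exact: is_derive_cst.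
apply: is_derive_eq; rewrite ?scaler0 /GRing.scale /=.
by rewrite subr0; field.
Qed.

Lemma cosum_sinum_sqr w :
  cosum w ^+ 2 + sinum w ^+ 2 =
  \sum_(j < M.+1) \sum_(k < M.+1) p j * p k * cos (2 * (j%:R - k%:R) * w).
Proof.
rewrite /cosum /sinum !expr2 !mulr_suml -big_split; apply: eq_bigr => j _ /=.
rewrite !mulr_sumr -big_split; apply: eq_bigr => k _ /=.
have -> : 2 * (j%:R - k%:R) * w = (2 * j%:R - M%:R) * w + - ((2 * k%:R - M%:R) * w).
  by ring.
by rewrite cosD cosN sinN; ring.
Qed.

(** Termwise derivatives rebuild the double cosine sum for [|P|^2], and the diagonal indicators add
    up to [mass]. *)
Lemma is_derive_hilb w :
  is_derive w 1 hilb (2 * (cosum w ^+ 2 + sinum w ^+ 2 - mass)).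
Proof.
rewrite (_ : hilb = \sum_(j < M.+1) \sum_(k < M.+1)
    (fun t => p j * p k * (sin (2 * (j%:R - k%:R) * t) / (j%:R - k%:R)))); last first.
  apply/funext => t; rewrite fct_sumE; apply: eq_bigr => j _.
  by rewrite fct_sumE.
have D : is_derive w 1 (\sum_(j < M.+1) \sum_(k < M.+1)
    (fun t => p j * p k * (sin (2 * (j%:R - k%:R) * t) / (j%:R - k%:R))))
    (\sum_(j < M.+1) \sum_(k < M.+1) p j * p k *
      (2 * (cos (2 * (j%:R - k%:R) * w) - (j%:R - k%:R == 0 :> R)%:R))).
  apply: is_derive_sum => j; apply: is_derive_sum => k.
  exact: is_derive_sinc.
apply: (is_derive_eq D).
rewrite cosum_sinum_sqr /mass -sumrB mulr_sumr; apply: eq_bigr => j _.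
have -> : p j ^+ 2 = \sum_(k < M.+1) p j * p k * (j%:R - k%:R == 0 :> R)%:R.
  rewrite (bigD1 j) //= subrr eqxx mulr1 big1 ?addr0 // => k kj.
  have /negbTE jk : j != k :> nat by rewrite eq_sym.
  by rewrite subr_eq0 eqr_nat jk mulr0.
by rewrite -sumrB mulr_sumr; apply: eq_bigr => k _; ring.
Qed.

Lemma hilb0 : hilb 0 = 0.
Proof.
by rewrite /hilb big1 // => j _; rewrite big1 // => k _; rewrite mulr0 sin0 mul0r mulr0.
Qed.

Lemma sin_natpi n : sin (n%:R * pi) = 0 :> R.
Proof.
elim: n => [|n IH]; first by rewrite mul0r sin0.
by rewrite -natr1 mulrDl mul1r sinDpi IH oppr0.
Qed.

Lemma hilb_pihalf : hilb (pi / 2) = 0.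
Proof.
rewrite /hilb big1 // => j _; rewrite big1 // => k _.
rewrite (_ : 2 * _ * _ = j%:R * pi - k%:R * pi); last by field.
by rewrite sinB !sin_natpi !(mul0r, mulr0) subrr mul0r mulr0.
Qed.

(* A primitive of [2 * |P|^2], where P is the trigonometric polynomial with real
   part [cosum] and imaginary part [sinum]. *)
Definition prim w : R := hilb w + 2 * mass * w.

Lemma is_derive_prim w :
  is_derive w 1 prim (2 * (cosum w ^+ 2 + sinum w ^+ 2)).
Proof.
have D := is_derive_hilb w.
rewrite /prim; apply: is_derive_eq; rewrite /GRing.scale /= ?scaler0; ring.
Qed.

Lemma prim_homo a b : a <= b -> prim a <= prim b.
Proof.
move=> ab; apply: (is_derive_homo ab (fun x _ => is_derive_prim x)) => x _.
by rewrite mulr_ge0 // addr_ge0 ?sqr_ge0.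
Qed.

Lemma prim0 : prim 0 = 0. Proof. by rewrite /prim hilb0 mulr0 addr0. Qed.

(** This is Parseval: the integral of [2 |P|^2] over [[0, pi/2]] is [pi * mass]. *)
Lemma prim_pihalf : prim (pi / 2) = pi * mass.
Proof. by rewrite /prim hilb_pihalf; field. Qed.

(** The function [expR (K t) (c - hilb t)] is nondecreasing: the hypothesis absorbs the [|P|^2] part
    of the derivative, and the remaining [2 * mass] is nonnegative. *)
Lemma gronwall (c K a b : R) : a <= b ->
  (forall w, 2 * (cosum w ^+ 2 + sinum w ^+ 2) <= K * (c - hilb w)) ->
  c - hilb a <= expR (K * (b - a)) * (c - hilb b).
Proof.
move=> ab H.
have : expR (K * a) * (c - hilb a) <= expR (K * b) * (c - hilb b).
  apply: (@is_derive_homo _ (fun t => expR (K * t) * (c - hilb t))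
    (fun t => expR (K * t) *
      (K * (c - hilb t) - 2 * (cosum t ^+ 2 + sinum t ^+ 2 - mass))) a b ab) => t _.
    have D := is_derive_hilb t.
    apply: is_derive_eq; rewrite /GRing.scale /= ?scaler0; ring.
  rewrite mulr_ge0 ?expR_ge0 // subr_ge0.
  by have := H t; have := mass_ge0; lra.
move=> H2.
rewrite -(@ler_pM2l _ (expR (K * a))) ?expR_gt0 // mulrA -expRD.
by rewrite (_ : K * a + _ = K * b) //; ring.
Qed.

End HilbertForm.

(** * A cluster of points together with an isolated point *)

Definition weighted_hilbert (R : realType) (C : R) : Prop :=
  forall (N : nat) (lambda : 'I_N -> R) (w : 'I_N -> R[i]),
    (2 <= N)%N -> injective lambda ->
    Normc.normc (\sum_(m < N) \sum_(n < N | m != n)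
                    w m * (w n)^*%C / ((lambda m - lambda n)%:C)%C)
    <= C * \sum_(m < N) Normc.normc (w m) ^+ 2 / min_gap lambda m.

Section Configuration.
Variable R : realType.
Implicit Types (C c w : R) (z : R[i]).

Lemma Im_sum (I : Type) (r : seq I) (P : pred I) (F : I -> R[i]) :
  complex.Im (\sum_(i <- r | P i) F i) = \sum_(i <- r | P i) complex.Im (F i).
Proof. by apply: (big_morph (@complex.Im R)) => // -[x y] [x' y']. Qed.

Lemma Im_le_normc z : `|complex.Im z| <= Normc.normc z.
Proof.
case: z => x y /=; rewrite -sqrtr_sqr ler_wsqrtr //.
by rewrite lerDr sqr_ge0.
Qed.

(** This takes imaginary parts with [w = a + i b]. Diagonal terms may be included because their
    numerators vanish, and any positive lower bounds [delta] for the gaps suffice, so exact minima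
    need not be computed. *)
Lemma weighted_hilbert_real C (N : nat) (lambda a b delta : 'I_N -> R) :
  weighted_hilbert C -> 0 <= C -> (2 <= N)%N -> injective lambda ->
  (forall m, 0 < delta m) ->
  (forall m k, k != m -> delta m <= `|lambda k - lambda m|) ->
  `|\sum_(m < N) \sum_(k < N) (b m * a k - a m * b k) / (lambda m - lambda k)|
  <= C * \sum_(m < N) (a m ^+ 2 + b m ^+ 2) / delta m.
Proof.
move=> H C0 N2 li d0 dl.
have := H N lambda (fun m => a m +i* b m)%C N2 li.
set S := (X in Normc.normc X) => HS.
have ImS : complex.Im S =
    \sum_(m < N) \sum_(k < N) (b m * a k - a m * b k) / (lambda m - lambda k).
  rewrite Im_sum; apply: eq_bigr => m _; rewrite Im_sum big_mkcond /=.
  apply: eq_bigr => k _; case: eqVneq => [->|mk].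
    by rewrite /= [b k * a k]mulrC subrr mul0r.
  have lmk : lambda m - lambda k != 0 by rewrite subr_eq0 (inj_eq li).
  by rewrite /= expr0n /= addr0; field.
rewrite -ImS; apply: (le_trans (Im_le_normc S)); apply: (le_trans HS).
rewrite ler_wpM2l //; apply: ler_sum => m _ /=.
rewrite sqr_sqrtr ?addr_ge0 ?sqr_ge0 //.
rewrite ler_wpM2l ?addr_ge0 ?sqr_ge0 //.
have [[k km ->] _] := min_gapP lambda m N2.
by rewrite lef_pV2 ?posrE ?(lt_le_trans (d0 m)) ?dl.
Qed.

Variables (p : nat -> R) (M n : nat).
Hypothesis n_gt0 : (0 < n)%N.

Let node (i : nat) : R := if i is j.+1 then (n + j)%:R^-1 else 0.

(** Among reciprocals of positive integers, the neighbour nearest to [1/i] is [1/(i+1)]. *)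
Lemma recip_gap (i j : nat) : (0 < i)%N -> (0 < j)%N -> i != j ->
  (i%:R * (i%:R + 1))^-1 <= `|j%:R^-1 - i%:R^-1| :> R.
Proof.
move=> i0 j0 ij.
have i0R : (0 : R) < i%:R by rewrite ltr0n.
have j0R : (0 : R) < j%:R by rewrite ltr0n.
have -> : j%:R^-1 - i%:R^-1 = (i%:R - j%:R) / (i%:R * j%:R) :> R.
  by field; rewrite !gt_eqF.
rewrite normrM (gtr0_norm (x := (_ * _)^-1)) ?invr_gt0 ?mulr_gt0 //.
rewrite invfM (invfM i%:R) mulrCA ler_wpM2l ?invr_ge0 ?ler0n //.
rewrite ler_pdivlMr // mulrC ler_pdivrMr ?addr_gt0 //.
case: (ltngtP i j) ij => // [lt|gt] _.
- have : i%:R + 1 <= j%:R :> R by rewrite natr1 ler_nat.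
  move=> ?; rewrite ler0_norm ?subr_le0 ?ler_nat; [nra|exact: ltnW].
- have : j%:R + 1 <= i%:R :> R by rewrite natr1 ler_nat.
  move=> ?; rewrite ger0_norm ?subr_ge0 ?ler_nat; [nra|exact: ltnW].
Qed.

Lemma hilbert_point_bound C w : 0 < C -> weighted_hilbert C -> sinum p M w = 0 ->
  cosum p M w ^+ 2 <=
  C * (n + M)%:R * (C * (1 + n%:R^-1) * mass p M - hilb p M w).
Proof.
move=> C0 H sw.
have nj0 j : (0 : R) < (n + j)%:R by rewrite ltr0n ltn_addr.
have njD j : n%:R + j%:R != 0 :> R by rewrite -natrD gt_eqF.
set L : R := (n + M)%:R; have L0 : 0 < L := nj0 M.
(* The weight at 0 is purely imaginary; this value of [c] optimizes the bound. *)
pose c := cosum p M w / (C * L).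
pose th (j : nat) : R := (2 * j%:R - M%:R) * w.
pose a i := if i is j.+1 then p j * cos (th j) / (n + j)%:R else 0.
pose b i := if i is j.+1 then p j * sin (th j) / (n + j)%:R else c.
(* The point nearest to 0 is [1/(n+M)], at distance [L^-1]; the cluster points get the bound of
   [recip_gap], which is also below their distance to 0. *)
pose d i : R := if i is j.+1 then ((n + j)%:R * ((n + j)%:R + 1))^-1 else L^-1.
have d0 (i : 'I_M.+2) : 0 < d i.
  by case: i => -[|i] ? /=; rewrite invr_gt0 // mulr_gt0 // addr_gt0.
have li : injective (fun i : 'I_M.+2 => node i).
  move=> [i hi] [j hj] /= E; apply: val_inj => /=.
  case: i j {hi hj} E => [|i] [|j] //= E.
  - by have := nj0 j; rewrite -invr_gt0 -E ltxx.
  - by have := nj0 i; rewrite -invr_gt0 E ltxx.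
  - by move/invr_inj/eqP: E; rewrite eqr_nat eqn_add2l => /eqP ->.
have dl (m k : 'I_M.+2) : k != m -> d m <= `|node k - node m|.
  case: m k => [[|i] hi] [[|j] hj] //= ij.
  - rewrite subr0 ger0_norm ?invr_ge0 ?ler0n // lef_pV2 ?posrE //.
    by rewrite ler_nat leq_add2l -ltnS.
  - rewrite sub0r normrN ger0_norm ?invr_ge0 ?ler0n // lef_pV2 ?posrE ?mulr_gt0 ?addr_gt0 //.
    by have := nj0 i; nra.
  - by apply: recip_gap; rewrite ?ltn_addr // eqn_add2l eq_sym.
have := weighted_hilbert_real (fun i : 'I_M.+2 => a i) (fun i : 'I_M.+2 => b i)
  H (ltW C0) isT li d0 dl.
have -> : \sum_(m < M.+2) \sum_(k < M.+2) (b m * a k - a m * b k) / (node m - node k)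
    = - (hilb p M w + 2 * c * cosum p M w).
  pose F i k := (b i * a k - a i * b k) / (node i - node k).
  (* Row 0 and column 0 contribute [- c * cosum] each, and the cluster block contributes
     [- hilb]. *)
  transitivity (\sum_(k < M.+2) F 0%N k + \sum_(i < M.+1) \sum_(k < M.+2) F i.+1 k).
    by rewrite big_ord_recl.
  have -> : \sum_(k < M.+2) F 0%N k = - (c * cosum p M w).
    rewrite big_ord_recl /cosum mulr_sumr -sumrN {1}/F /= subrr invr0 mulr0 add0r.
    apply: eq_bigr => i _; rewrite -/(th i) /F /= !add0n.
    by field; rewrite njD.
  have -> : \sum_(i < M.+1) \sum_(k < M.+2) F i.+1 k
     = - (c * cosum p M w) - hilb p M w; last by ring.
  rewrite /cosum /hilb mulr_sumr -sumrN -sumrB; apply: eq_bigr => i _.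
  rewrite big_ord_recl /= -sumrN; congr (_ + _).
    by rewrite -/(th i) /F /=; field; rewrite njD.
  apply: eq_bigr => k _; rewrite /F /=.
  rewrite (_ : 2 * (_ - _) * w = th i - th k); last by rewrite /th; ring.
  case: (eqVneq (i : nat) k) => [->|ik]; first by rewrite !subrr sin0 !(invr0, mul0r, mulr0) oppr0.
  have ik' : i%:R - k%:R != 0 :> R by rewrite subr_eq0 eqr_nat.
  have -> : (n + i)%:R^-1 - (n + k)%:R^-1 = - (i%:R - k%:R) / ((n + i)%:R * (n + k)%:R) :> R.
    rewrite (_ : i%:R - k%:R = (n + i)%:R - (n + k)%:R :> R); last by rewrite !natrD; ring.
    by field; rewrite !njD.
  rewrite sinD sinN cosN; field.
  by rewrite ik' !njD.
rewrite normrN => H1; have := le_trans (ler_norm _) H1; clear H1.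
rewrite big_ord_recl.
have -> : (a (@ord0 M.+1) ^+ 2 + b (@ord0 M.+1) ^+ 2) / d (@ord0 M.+1) = c ^+ 2 * L.
  by rewrite /= invrK expr0n /= add0r.
have : \sum_(i < M.+1) (a (lift ord0 i) ^+ 2 + b (lift ord0 i) ^+ 2) / d (lift ord0 i)
    <= (1 + n%:R^-1) * mass p M.
  rewrite /mass mulr_sumr; apply: ler_sum => i _; rewrite /= !add0n invrK.
  (* The weight carries [1/(n+i)^2] and the inverse gap is [(n+i)(n+i+1)]; their product
     [1 + 1/(n+i)] is at most [1 + 1/n]. *)
  have -> : ((p i * cos (th i) / (n + i)%:R) ^+ 2 + (p i * sin (th i) / (n + i)%:R) ^+ 2)
      * ((n + i)%:R * ((n + i)%:R + 1)) = (1 + (n + i)%:R^-1) * p i ^+ 2.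
    rewrite -[RHS]mulr1 -[X in _ = _ * X](cos2Dsin2 (th i)); field; exact: njD.
  rewrite ler_wpM2r ?sqr_ge0 // lerD2l lef_pV2 ?posrE ?ltr0n ?ltn_addr //.
  by rewrite ler_nat leq_addr.
move=> HQ H1.
have H2 : hilb p M w + 2 * c * cosum p M w <= C * (c ^+ 2 * L) + C * ((1 + n%:R^-1) * mass p M).
  by apply: (le_trans H1); rewrite mulrDr lerD2l ler_wpM2l // ltW.
have CL : C * L != 0 by rewrite mulf_neq0 ?gt_eqF.
(* With this [c], the difference [2 c cosum - C c^2 L] equals [cosum^2 / (C L)]. *)
have E1 : c * cosum p M w = cosum p M w ^+ 2 / (C * L).
  by rewrite /c; field; rewrite njD gt_eqF.
have E2 : C * (c ^+ 2 * L) = cosum p M w ^+ 2 / (C * L).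
  by rewrite /c; field; rewrite njD gt_eqF.
rewrite mulrC -ler_pdivrMr ?mulr_gt0 //; lra.
Qed.

End Configuration.

(** * The trial sequence *)

Section TrialSequence.
Variables (R : realType) (M : nat) (x : R).
Hypotheses (x_gt0 : 0 < x) (x_le1 : x <= 1).
Implicit Types (a h w : R).

Let p := chebc (cos x)^-1 M.
Let U w := chebU M ((cos x)^-1 * cos w).

Lemma cosx_ge : 1 / 2 <= cos x.
Proof.
have := cos_ge_sqr (ltW x_gt0).
have : x ^+ 2 <= 1 by rewrite expr_le1 // ltW.
lra.
Qed.

Let cosx_gt0 : 0 < cos x.
Proof. by have := cosx_ge; lra. Qed.

Lemma pihalf_ge1 : 1 <= pi / 2 :> R.
Proof. by have := pi_ge2 R; lra. Qed.

Lemma is_derive_trial w : is_derive w 1 (prim p M) (2 * U w ^+ 2).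
Proof.
apply: (is_derive_eq (is_derive_prim p M w)).
have [cE sE] := chebc_trig (cos x)^-1 M w.
by rewrite /cosum /sinum cE sE expr0n addr0.
Qed.

(** Beyond [x] the argument [v = cos w / cos x] is below 1, and [1 - v^2 >= cos^2 x - cos^2 w = sin
    (w - x) sin (w + x) >= sin^2 (w - x)]; then [chebU_sqr_le] applies. *)
Lemma trial_tail_sqr w : x < w -> w <= pi / 2 -> U w ^+ 2 <= (sin (w - x) ^+ 2)^-1.
Proof.
have x0 := x_gt0; move=> xw wpi.
have s0 : 0 < sin (w - x) by apply: sin_gt0_pihalf; apply/andP; split; lra.
have cw : 0 <= cos w by apply: cos_ge0_pihalf; apply/andP; split; lra.
have sx : 0 <= sin x by apply: sin_ge0_pi; apply/andP; split; have := pihalf_ge1; lra.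
rewrite -[X in _ <= X]mul1r ler_pdivlMr ?exprn_gt0 // mulrC.
apply: le_trans (chebU_sqr_le M ((cos x)^-1 * cos w)).
rewrite ler_wpM2r ?sqr_ge0 //.
have cxV : 1 <= (cos x)^-1 ^+ 2.
  by rewrite exprVn invf_ge1 ?exprn_gt0 // expr_le1 ?cos_le1 // ltW.
have E : cos x ^+ 2 - cos w ^+ 2 = sin (w - x) * sin (w + x).
  rewrite !sinD cosN sinN.
  have Ex := cos2Dsin2 x; have Ew := cos2Dsin2 w.
  rewrite (_ : cos x ^+ 2 - cos w ^+ 2
    = cos x ^+ 2 * (cos w ^+ 2 + sin w ^+ 2) - cos w ^+ 2 * (cos x ^+ 2 + sin x ^+ 2)).
    by ring.
  by rewrite Ex Ew !mulr1.
have sle : sin (w - x) <= sin (w + x).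
  rewrite !sinD cosN sinN; have := mulr_ge0 cw sx; lra.
have H : sin (w - x) ^+ 2 <= cos x ^+ 2 - cos w ^+ 2.
  by rewrite E expr2 ler_wpM2l // ltW.
apply: (le_trans H).
have -> : 1 - ((cos x)^-1 * cos w) ^+ 2 = (cos x)^-1 ^+ 2 * (cos x ^+ 2 - cos w ^+ 2).
  by field; rewrite gt_eqF.
rewrite ler_peMl //; exact: le_trans (sqr_ge0 _) H.
Qed.

(** The bound of [trial_tail_sqr] is integrated with the primitive [- cot (w - x)]; the cotangent at
    [pi/2] is nonnegative and is dropped. *)
Lemma trial_tail a : x < a -> a <= pi / 2 ->
  prim p M (pi / 2) - prim p M a <= 2 / sin (a - x).
Proof.
have x0 := x_gt0; move=> xa api.
have s0 w : a <= w <= pi / 2 -> 0 < sin (w - x).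
  by move=> /andP[aw wpi]; apply: sin_gt0_pihalf; apply/andP; split; lra.
have : - prim p M a - 2 * (cos (a - x) / sin (a - x))
    <= - prim p M (pi / 2) - 2 * (cos (pi / 2 - x) / sin (pi / 2 - x)).
  apply: (@is_derive_homo _ (fun w => - prim p M w - 2 * (cos (w - x) / sin (w - x)))
    (fun w => 2 * (sin (w - x) ^+ 2)^-1 - 2 * U w ^+ 2) a (pi / 2) api) => w wab.
    have D := is_derive_trial w.
    have sn0 : sin (w - x) != 0 by rewrite gt_eqF // s0.
    have D2 := @is_deriveV R (fun t => sin (t - x)) w 1 _ sn0 _.
    apply: is_derive_eq; rewrite /GRing.scale /= ?scaler0.
    rewrite -[X in _ = 2 * X - _]mul1r -[X in _ = 2 * (X * _) - _](cos2Dsin2 (w - x)).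
    by field.
  have /andP[aw wpi] := wab.
  rewrite -mulrBr mulr_ge0 // subr_ge0 trial_tail_sqr //; lra.
have c0 : 0 <= cos (pi / 2 - x) / sin (pi / 2 - x).
  rewrite divr_ge0 //; last by rewrite ltW // s0 //; lra.
  by apply: cos_ge0_pihalf; apply/andP; split; lra.
have : cos (a - x) / sin (a - x) <= 1 / sin (a - x).
  by rewrite ler_wpM2r ?cos_le1 // invr_ge0 ltW // s0 // lexx.
lra.
Qed.

(** To the left of [x] the argument is [1 + e] with [e >= cos (x - h) - cos x = 2 sin (x - h/2) sin
    (h/2)], and [chebU_ge_cube] turns this into growth. *)
Lemma trial_gap_ge h w : 0 <= h -> h <= x -> 0 <= w <= x - h ->
  (x - h / 2) * h / 4 * M%:R ^+ 3 / 3 <= U w.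
Proof.
have x0 := x_gt0; have x1 := x_le1; move=> h0 hx /andP[w0 wh].
have M0 : (0 : R) <= M%:R by rewrite ler0n.
pose e := (cos x)^-1 * cos w - 1.
have He : (x - h / 2) * h / 4 <= e.
  have H1 : cos (x - h) <= cos w.
    move: wh; rewrite le_eqVlt => /orP[/eqP -> //|wh].
    have pi1 := pihalf_ge1.
    by rewrite ltW // ltr_cos ?in_itv //=; apply/andP; split; lra.
  have H2 : (x - h / 2) * h / 4 <= cos (x - h) - cos x.
    have -> : cos (x - h) - cos x = 2 * sin (x - h / 2) * sin (h / 2).
      rewrite [in cos (x - h)](_ : x - h = (x - h / 2) - h / 2); last by field.
      rewrite [in cos x](_ : x = (x - h / 2) + h / 2); last by field.
      by rewrite !cosD cosN sinN; ring.
    have S1 : (x - h / 2) / 2 <= sin (x - h / 2) by apply: sin_ge_half; lra.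
    have S2 : (h / 2) / 2 <= sin (h / 2) by apply: sin_ge_half; lra.
    have P1 : 0 <= (x - h / 2) / 2 by lra.
    have P2 : 0 <= (h / 2) / 2 by lra.
    have := ler_pM P1 P2 S1 S2; lra.
  have H3 : cos w - cos x <= (cos x)^-1 * (cos w - cos x).
    rewrite ler_peMl ?invf_ge1 ?cos_le1 //.
    have : 0 <= (x - h / 2) * h by rewrite mulr_ge0 //; lra.
    lra.
  have : (cos x)^-1 * (cos w - cos x) = e.
    by rewrite /e mulrBr mulVf ?gt_eqF.
  lra.
have e0 : 0 <= e by apply: le_trans He; rewrite mulr_ge0 // mulr_ge0 //; lra.
have := chebU_ge_cube M e0; rewrite (_ : 1 + e = (cos x)^-1 * cos w); last by rewrite /e; ring.
apply: le_trans; rewrite ler_wpM2r // ler_wpM2r // exprn_ge0 //.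
Qed.

Lemma prim_gap_ge h : 0 <= h -> 2 * h <= x ->
  2 * h * ((x - h / 2) * h / 4 * M%:R ^+ 3 / 3) ^+ 2 <= prim p M (x - h) - prim p M (x - 2 * h).
Proof.
have x0 := x_gt0; have x1 := x_le1; move=> h0 hx; set c := (X in X ^+ 2).
have c0 : 0 <= c by rewrite /c !mulr_ge0 ?exprn_ge0 ?ler0n //; lra.
have : prim p M (x - 2 * h) - 2 * c ^+ 2 * (x - 2 * h)
    <= prim p M (x - h) - 2 * c ^+ 2 * (x - h).
  apply: (@is_derive_homo _ (fun w => prim p M w - 2 * c ^+ 2 * w)
    (fun w => 2 * U w ^+ 2 - 2 * c ^+ 2)) => [|w wab|w /andP[wa wb]]; first by lra.
    have D := is_derive_trial w.
    by apply: is_derive_eq; rewrite /GRing.scale /= ?scaler0; ring.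
  have H : c <= U w by apply: trial_gap_ge => //; lra.
  rewrite -mulrBr mulr_ge0 // subr_ge0 ler_pXn2r // nnegrE //; exact: le_trans H.
lra.
Qed.

(** This crude bound serves only to control [mass]. It applies [chebU_le_pow] with [s = tan x] and
    [q = 1 + 4 x]; for [x = r/M] the exponential is [expR (4 r)], uniformly in [M]. *)
Lemma trial_le w : 0 <= w <= pi / 2 ->
  `|U w| <= (M%:R + 1) * expR (4 * x * M%:R).
Proof.
have x0 := x_gt0; have x1 := x_le1; move=> /andP[w0 wpi].
have cw : 0 <= cos w by apply: cos_ge0_pihalf; apply/andP; split; lra.
have sx : 0 <= sin x by apply: sin_ge0_pi; apply/andP; split; have := pihalf_ge1; lra.
have v0 : 0 <= (cos x)^-1 * cos w by rewrite mulr_ge0 // invr_ge0 ltW.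
have vle : (cos x)^-1 * cos w <= (cos x)^-1 by rewrite ler_piMr ?cos_le1 // invr_ge0 ltW.
have s0 : 0 <= sin x / cos x by rewrite divr_ge0 // ltW.
have vs : ((cos x)^-1 * cos w) ^+ 2 - 1 <= (sin x / cos x) ^+ 2.
  have -> : (sin x / cos x) ^+ 2 = (cos x)^-1 ^+ 2 - 1.
    rewrite expr_div_n (_ : sin x ^+ 2 = 1 - cos x ^+ 2); last by rewrite -(cos2Dsin2 x); ring.
    by field; rewrite gt_eqF.
  by rewrite lerD2r ler_pXn2r // nnegrE // invr_ge0 ltW.
have vsq : (cos x)^-1 * cos w + sin x / cos x <= 1 + 4 * x.
  have H : (cos x)^-1 + sin x / cos x <= 1 + 4 * x.
    rewrite (_ : (cos x)^-1 + _ = (1 + sin x) / cos x); last by field; rewrite gt_eqF.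
    rewrite ler_pdivrMr //.
    have H1 := sin_le_id (ltW x_gt0); have H2 := cos_ge_sqr (ltW x_gt0).
    have H3 : x * x <= x by rewrite ler_piMr // ltW.
    have H4 : (1 + 4 * x) * (1 - x ^+ 2 / 2) <= (1 + 4 * x) * cos x.
      by rewrite ler_wpM2l //; lra.
    have H5 : x * (x * x) <= x by rewrite ler_piMr ?(le_trans H3) // ltW.
    lra.
  lra.
have q1 : 1 <= 1 + 4 * x by lra.
apply: (le_trans (chebU_le_pow M v0 s0 vs vsq q1)).
rewrite ler_wpM2l ?addr_ge0 ?ler0n // expRM_natr lerXn2r ?nnegrE ?expR_ge0 ?expR_ge1Dx //; lra.
Qed.

Lemma prim_le a : 0 <= a <= pi / 2 ->
  prim p M a <= 2 * ((M%:R + 1) * expR (4 * x * M%:R)) ^+ 2 * a.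
Proof.
have x0 := x_gt0; have x1 := x_le1; move=> /andP[a0 api]; set c := (X in X ^+ 2).
have : 2 * c ^+ 2 * 0 - prim p M 0 <= 2 * c ^+ 2 * a - prim p M a.
  apply: (@is_derive_homo _ (fun w => 2 * c ^+ 2 * w - prim p M w)
    (fun w => 2 * c ^+ 2 - 2 * U w ^+ 2)) => [//|w wab|w /andP[wa wb]].
    have D := is_derive_trial w.
    by apply: is_derive_eq; rewrite /GRing.scale /= ?scaler0; ring.
  have H : `|U w| <= c by apply: trial_le; lra.
  rewrite -mulrBr mulr_ge0 // subr_ge0 -[U w ^+ 2]ger0_norm ?sqr_ge0 // normrX.
  by rewrite ler_pXn2r // nnegrE //; exact: le_trans H.
rewrite prim0; lra.
Qed.

End TrialSequence.

(** * The trial sequence at the scale x = r/M *)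

Section ScaledTrial.
Variables (R : realType) (M : nat) (r : R).
Hypotheses (r_ge2 : 2 <= r) (r_leM : 2 * (r + 1) <= M%:R).

Let h : R := M%:R^-1.
Let x := r * h.
Let p := chebc (cos x)^-1 M.

Lemma scale_gt0 : 0 < M%:R :> R.
Proof. by have := r_ge2; have := r_leM; lra. Qed.

Lemma scaleV : h * M%:R = 1.
Proof. by rewrite mulVf // gt_eqF // scale_gt0. Qed.

Lemma scale_edge : [/\ 0 < h, 2 * h <= x & x + h <= 1 / 2].
Proof.
have M0 := scale_gt0; have h0 : 0 < h by rewrite invr_gt0.
split=> //; first by rewrite /x (ler_wpM2r (ltW h0)).
rewrite (_ : x + h = (r + 1) * h); last by rewrite /x; ring.
by rewrite -(ler_pM2r M0) -mulrA scaleV; have := r_leM; lra.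
Qed.

Lemma scaled_low :
  r ^+ 2 / 288 * M%:R <= prim p M (pi / 2) - prim p M (x - 2 * h).
Proof.
have M0 := scale_gt0; have [h0 h2x xh] := scale_edge; have r2 := r_ge2.
have x0 : 0 < x by lra.
have x1 : x <= 1 by lra.
have mono : prim p M (x - h) <= prim p M (pi / 2).
  by apply: prim_homo; have := pihalf_ge1 R; lra.
apply: (le_trans _ (lerD mono (lexx _))).
apply: (le_trans _ (prim_gap_ge M x0 x1 (ltW h0) h2x)).
have Mn0 : M%:R != 0 :> R by rewrite gt_eqF.
rewrite (_ : (x - h / 2) * h / 4 * M%:R ^+ 3 / 3 = (r - 1 / 2) / 12 * M%:R); last first.
  by rewrite /x /h; field.
rewrite (_ : 2 * h * _ = ((r - 1 / 2) / 6) ^+ 2 / 2 * M%:R); last by rewrite /h; field.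
rewrite (ler_wpM2r (ltW M0)) //.
(* The goal amounts to [r/2 <= r - 1/2] after squaring; this product supplies the quadratic term for
   [lra]. *)
have : 0 <= (r - 2) * (r - 2 / 3) by rewrite mulr_ge0 //; lra.
lra.
Qed.

Lemma scaled_tail : prim p M (pi / 2) - prim p M (x + h) <= 4 * M%:R.
Proof.
have M0 := scale_gt0; have [h0 h2x xh] := scale_edge; have pih := pihalf_ge1 R.
have x0 : 0 < x by lra.
have x1 : x <= 1 by lra.
have xa : x < x + h by lra.
have api : x + h <= pi / 2 by lra.
apply: (le_trans (trial_tail M x0 x1 xa api)).
rewrite (_ : x + h - x = h); last by ring.
have sh : h / 2 <= sin h by apply: sin_ge_half; lra.
have sh0 : 0 < sin h by lra.
rewrite ler_pdivrMr //.
have := ler_wpM2l (ltW M0) sh; have := scaleV; lra.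
Qed.

(** By Parseval, [prim_le] on [[0, x + h]], of length [(r + 1)/M], and [scaled_tail] beyond it bound
    the mass by a constant depending on [r] times [M]. *)
Lemma scaled_mass : pi * mass p M <= (8 * (r + 1) * expR (4 * r) ^+ 2 + 4) * M%:R.
Proof.
have tail := scaled_tail.
have M0 := scale_gt0; have [h0 h2x xh] := scale_edge; have r2 := r_ge2.
suff gap : prim p M (x + h) <= 8 * (r + 1) * expR (4 * r) ^+ 2 * M%:R.
  by rewrite -prim_pihalf; lra.
have x0 : 0 < x by lra.
have x1 : x <= 1 by lra.
have xhpi : 0 <= x + h <= pi / 2 by apply/andP; have := pihalf_ge1 R; lra.
apply: (le_trans (prim_le M x0 x1 xhpi)).
rewrite -(mulrA 4 x) (_ : x * M%:R = r); last by rewrite /x -mulrA scaleV mulr1.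
have M2 : (M%:R + 1) ^+ 2 <= (2 * M%:R) ^+ 2 :> R.
  by rewrite lerXn2r ?nnegrE //; have := r_leM; lra.
have e0 : 0 <= 2 * expR (4 * r) ^+ 2 * (x + h).
  by rewrite !mulr_ge0 ?exprn_ge0 ?expR_ge0 //; lra.
have := ler_wpM2r e0 M2.
have -> : (2 * M%:R) ^+ 2 * (2 * expR (4 * r) ^+ 2 * (x + h)) =
     8 * (r + 1) * expR (4 * r) ^+ 2 * M%:R.
  by rewrite /x /h; field; rewrite gt_eqF.
by rewrite exprMn; lra.
Qed.

(** The factor is [(pi + 2 (r + 1)) / M], at most [(r + 2) pi / M] since [pi >= 2]. *)
Lemma scaled_err A : pi * mass p M <= A * M%:R -> (r + 2) * A <= M%:R ->
  (pi * h + 2 * (x + h)) * mass p M <= M%:R.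
Proof.
move=> mA MA; have M0 := scale_gt0; have [h0 _ _] := scale_edge; have r2 := r_ge2.
have m0 := mass_ge0 p M.
rewrite (_ : (pi * h + _) * _ = (pi + 2 * (r + 1)) * mass p M * h); last by rewrite /x; ring.
rewrite -[leRHS]mulr1 -[X in _ <= _ * X]scaleV (mulrC h) mulrA (ler_wpM2r (ltW h0)) //.
apply: (@le_trans _ _ ((r + 2) * (pi * mass p M))).
  rewrite mulrA (ler_wpM2r m0) //.
  have : 0 <= (r + 1) * (pi - 2) by rewrite mulr_ge0 ?subr_ge0 ?pi_ge2 //; lra.
  lra.
apply: (@le_trans _ _ ((r + 2) * (A * M%:R))); first by rewrite ler_wpM2l //; lra.
by rewrite mulrA (ler_wpM2r (ltW M0)).
Qed.

(** With [n = M] the rate is [4 pi M] and the interval has length [3/M], hence [12 pi]. The error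
    term at the left endpoint is nonnegative and is dropped. *)
Lemma scaled_gronwall : weighted_hilbert (pi : R) ->
  prim p M (pi / 2) - prim p M (x - 2 * h) <=
  expR (12 * pi) * (prim p M (pi / 2) - prim p M (x + h)
    + (pi * h + 2 * (x + h)) * mass p M).
Proof.
move=> H; have M0 := scale_gt0; have [h0 h2x _] := scale_edge; have r2 := r_ge2.
have pi0 : 0 < pi :> R := pi_gt0 R.
have sin0 w : sinum p M w = 0 by have [] := chebc_trig (cos x)^-1 M w.
have m0 := mass_ge0 p M.
pose c := pi * (1 + h) * mass p M.
have cE w : c - hilb p M w =
    prim p M (pi / 2) - prim p M w + (pi * h + 2 * w) * mass p M.
  by rewrite prim_pihalf /prim /c; ring.
have G : c - hilb p M (x - 2 * h) <=
    expR (2 * pi * (M + M)%:R * ((x + h) - (x - 2 * h))) * (c - hilb p M (x + h)).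
  apply: gronwall => [|w]; first by lra.
  have Mgt0 : (0 < M)%N by rewrite -(ltr_nat R).
  have := hilbert_point_bound Mgt0 pi0 H (sin0 w).
  rewrite sin0 expr0n addr0 -/h -/c => K.
  by rewrite -!mulrA ler_wpM2l // mulrA.
have KE : 2 * pi * (M + M)%:R * ((x + h) - (x - 2 * h)) = 12 * pi.
  rewrite natrD (_ : _ - (x - 2 * h) = 3 * h); last by ring.
  by rewrite /h; field; rewrite gt_eqF.
rewrite KE !cE in G; apply: le_trans G.
by rewrite lerDl mulr_ge0 // addr_ge0 ?mulr_ge0 ?(ltW pi0) ?(ltW h0) // subr_ge0.
Qed.

End ScaledTrial.

(** * Contradiction at the constant pi *)

Lemma weighted_hilbert_le (R : realType) (C D : R) :
  C <= D -> weighted_hilbert C -> weighted_hilbert D.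
Proof.
move=> CD H N lambda w N2 li; apply: (le_trans (H N lambda w N2 li)).
rewrite ler_wpM2r //; apply: sumr_ge0 => m _; rewrite divr_ge0 ?exprn_ge0 //.
  exact: le_trans (normr_ge0 _) (Im_le_normc _).
by have [[k _ ->] _] := min_gapP lambda m N2.
Qed.

Lemma not_weighted_hilbert_pi (R : realType) : ~ weighted_hilbert (pi : R).
Proof.
move=> H.
have E0 := expR_gt0 (12 * pi : R).
(* The 5 is the 4 of [scaled_tail] plus the 1 of [scaled_err], and [1440 = 5 * 288]. *)
have [r r2 rE] : exists2 r : R, 2 <= r & expR (12 * pi) * 5 < r ^+ 2 / 288.
  move: (expR (12 * pi)) E0 => E E0; exists (1440 * E + 2); first by lra.
  by have := sqr_ge0 E; lra.
pose A := 8 * (r + 1) * expR (4 * r) ^+ 2 + 4.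
have rA : 0 <= (r + 2) * A.
  have r1 : 0 <= r + 1 by lra.
  have e1 := mulr_ge0 r1 (sqr_ge0 (expR (4 * r))).
  by apply: mulr_ge0; rewrite /A; lra.
(* Both summands are nonnegative, so one [M] above their sum meets both size conditions. *)
have B0 : 0 <= 2 * (r + 1) + (r + 2) * A by lra.
have := archi_boundP B0; set M := Num.bound _ => MB.
have Mr : 2 * (r + 1) <= M%:R by lra.
have MA : (r + 2) * A <= M%:R by lra.
have err := scaled_err r2 Mr (scaled_mass r2 Mr) MA.
have low := scaled_low r2 Mr; have tail := scaled_tail r2 Mr.
have up := lerD tail err.
have := le_trans low (le_trans (scaled_gronwall r2 Mr H) (ler_wpM2l (ltW E0) up)).
rewrite (_ : _ * (4 * _ + _) = expR (12 * pi) * 5 * M%:R); last by ring.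
by rewrite (ler_pM2r (scale_gt0 r2 Mr)) leNgt rE.
Qed.

Theorem theorem1p1 (R : realType) (C : R) :
  (forall (N : nat) (lambda : 'I_N -> R) (w : 'I_N -> R[i]),
    (2 <= N)%N -> injective lambda ->
    Normc.normc (\sum_(m < N) \sum_(n < N | m != n)
                    w m * (w n)^*%C / ((lambda m - lambda n)%:C)%C)
    <= C * \sum_(m < N) Normc.normc (w m) ^+ 2 / min_gap lambda m) ->
  pi < C.
Proof.
move=> H; rewrite ltNge; apply/negP => Cpi.
exact: (not_weighted_hilbert_pi (weighted_hilbert_le Cpi H)).
Qed.
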